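(* For every ordered graph $F$, \begin{align*} \rho_{<}(F) &= \inf\Big\{\alpha\in[0,1] : \text{for all sufficiently large } d, \text{ every graph } G \text{ on } \{0,1\}^d \text{ with } \tfrac{1}{d}\textstyle\sum_{\ell=1}^d \frac{e_\ell(G)}{\tau_{\ell,d}}\ge\alpha \text{ contains } F\Big\}\\ &= \inf\{\alpha\in[0,1] : \text{there exists } C \text{ such that every } (\alpha,C)\text{-rich graph contains } F\}. \end{align*}
   Context: An ordered graph is a graph whose vertex set carries a total order. An ordered graph $G$ contains an ordered graph $F$ if there is an injective order-preserving map $V(F)\to V(G)$ sending edges of $F$ to edges of $G$; otherwise $G$ is $F$-free. For ordered graphs $F,G$ (with $e(G)>0$), $\rho_{<}(F,G)=\max\{e(G')/e(G): G'\subseteq G,\ G'\ F\text{-free}\}$ and $\rho_{<}(F)=\inf_G\rho_{<}(F,G)$ over all ordered graphs $G$. For distinct $x,y\in\{0,1\}^d$, $\delta(x,y)=\min\{i: x_i\ne y_i\}$; graphs on $\{0,1\}^d$ are ordered lexicographically ($x<y$ iff $x_{\delta(x,y)}=0$). For a graph $G$ on $\{0,1\}^d$, an edge $uv$ is a level-$\ell$ edge if $\delta(u,v)=\ell$, $e_\ell(G)$ is the number of level-$\ell$ edges, and $\tau_{\ell,d}=2^{2d-\ell-1}$ is the number of pairs $\{u,v\}$ with $\delta(u,v)=\ell$. A level $\ell\in[d]$ is $\alpha$-rich if $e_\ell(G)\ge\alpha\tau_{\ell,d}$; $G$ is $(\alpha,C)$-rich if at least $C$ levels are $\alpha$-rich.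 ''Every $(\alpha,C)$-rich graph'' ranges over all $d$ and all such graphs on $\{0,1\}^d$. *)

(* Defs.v *)
From HB Require Import structures.
From mathcomp Require Import all_boot all_order all_algebra.
From mathcomp Require Import boolp classical_sets reals.
Set Implicit Arguments. Unset Strict Implicit. Unset Printing Implicit Defensive.
Import Order.TTheory GRing.Theory Num.Theory.
Local Open Scope ring_scope.

(* A (finite) graph on a vertex type V with a strict order [lt] is represented
   by its set of edges, each edge {u,v} stored exactly once as the oriented
   pair (u,v) with lt u v. *)
Definition wf_graph (V : finType) (lt : rel V) (G : {set V * V}) : bool :=
  [forall p in G, lt p.1 p.2].

Definition ord_lt (n : nat) : rel 'I_n := fun i j => (i < j)%N.
Definition ograph (n : nat) := {set 'I_n * 'I_n}.
Definition is_ograph (n : nat) (G : ograph n) := wf_graph (@ord_lt n) G.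

Definition containsR (k : nat) (F : ograph k) (V : finType) (lt : rel V)
    (G : {set V * V}) : bool :=
  [exists f : {ffun 'I_k -> V},
     [forall i : 'I_k, forall j : 'I_k, (i < j)%N ==> lt (f i) (f j)]
     && [forall p in F, (f p.1, f p.2) \in G]].

Definition ocontains (k : nat) (F : ograph k) (n : nat) (G : ograph n) :=
  containsR F (@ord_lt n) G.

(* rho_<(F,G): max of e(G')/e(G) over F-free subgraphs G' of G
   (0 if there is no F-free subgraph; this only happens for edgeless F). *)
Definition rhoFG (R : realType) (k : nat) (F : ograph k) (n : nat)
    (G : ograph n) : R :=
  \big[Num.max/0]_(G' : ograph n | (G' \subset G) && ~~ ocontains F G')
     (#|G'|%:R / #|G|%:R).

Definition rho (R : realType) (k : nat) (F : ograph k) : R :=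
  inf [set r | exists n (G : ograph n),
                 [/\ is_ograph G, (0 < #|G|)%N & r = rhoFG R F G]].

(* The hypercube {0,1}^d; coordinate i : 'I_d is the paper's coordinate i+1. *)
Definition cube (d : nat) := {ffun 'I_d -> bool}.

Definition lexlt (d : nat) : rel (cube d) := fun x y =>
  [exists i : 'I_d,
     [forall j : 'I_d, (j < i)%N ==> (x j == y j)] && ~~ x i && y i].

(* delta(x,y) = min{ i : x_i <> y_i }, 1-indexed as in the paper
   (only meaningful for x <> y). *)
Definition delta (d : nat) (x y : cube d) : nat :=
  (\big[minn/d]_(i : 'I_d | x i != y i) i).+1.

Definition cgraph (d : nat) := {set cube d * cube d}.
Definition is_cgraph (d : nat) (G : cgraph d) := wf_graph (@lexlt d) G.

Definition ccontains (k : nat) (F : ograph k) (d : nat) (G : cgraph d) :=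
  containsR F (@lexlt d) G.

Definition e_level (d : nat) (G : cgraph d) (l : nat) : nat :=
  #|[set p in G | delta p.1 p.2 == l]|.

Definition tau (l d : nat) : nat := 2 ^ (2 * d - l - 1).

Definition avg_density (R : realType) (d : nat) (G : cgraph d) : R :=
  d%:R^-1 * \sum_(1 <= l < d.+1) ((e_level G l)%:R / (tau l d)%:R).

Definition rich_level (R : realType) (alpha : R) (d : nat) (G : cgraph d)
    (l : nat) : bool :=
  alpha * (tau l d)%:R <= (e_level G l)%:R.

Definition rich (R : realType) (alpha : R) (C : nat) (d : nat) (G : cgraph d)
    : bool :=
  (C <= #|[set l : 'I_d | rich_level alpha G l.+1]|)%N.

(* Main.v *)
(** Three inequalities close a cycle.  Write [A] and [B] for the two sets of densities.

    [rho <= inf A]: if every dense enough cube graph contains [F], then the complete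
    graph on the cube, with every level given the same total weight, is a good
    weighted host; replacing each vertex by a set of labels turns the weights into
    edge densities of an unweighted host in which a random transversal clique is
    exactly uniform above every pair.

    [inf A <= inf B]: each level contributes at most [1] to the average density, so
    average density [a + e] forces at least [d * e] levels to be [a]-rich.

    [inf B <= rho]: a host on [n + 1] vertices is embedded into the cube at random as
    a caterpillar branching at random rich levels, one from each of [n] long blocks
    of rich levels, so that every edge of the host is almost uniformly distributed
    over the pairs of its level.  If the levels have density above [rhoFG F G], some
    embedding pulls the cube graph back to a subgraph of [G] that contains [F]. *)

Require Import Defs.
From HB Require Import structures.
From mathcomp Require Import all_boot all_order all_algebra.
From mathcomp Require Import boolp classical_sets reals.
From mathcomp Require Import lra ring zify.
Set Implicit Arguments. Unset Strict Implicit. Unset Printing Implicit Defensive.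
Import Order.TTheory GRing.Theory Num.Theory.
Local Open Scope ring_scope.

(** * Levels of the cube *)

(** The witness of [lexlt] made explicit; [l] counts from 0 while [delta] counts from 1. *)
Definition at_level (d : nat) (l : 'I_d) (x y : cube d) : bool :=
  [forall j : 'I_d, (j < l)%N ==> (x j == y j)] && ~~ x l && y l.

Lemma at_levelP (d : nat) (l : 'I_d) (x y : cube d) :
  reflect [/\ forall j : 'I_d, (j < l)%N -> x j = y j, x l = false & y l = true]
          (at_level l x y).
Proof.
apply: (iffP idP).
  case/andP=> /andP[/forallP xy /negbTE xl] yl; split=> // j jl.
  by have /implyP/(_ jl)/eqP := xy j.
case=> xy xl yl; rewrite /at_level xl yl !andbT.
by apply/forallP=> j; apply/implyP=> jl; apply/eqP/xy.
Qed.

Lemma lexltP (d : nat) (x y : cube d) :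
  reflect (exists l, at_level l x y) (lexlt x y).
Proof. exact: existsP. Qed.

Lemma at_level_delta (d : nat) (l : 'I_d) (x y : cube d) :
  at_level l x y -> delta x y = l.+1.
Proof.
case/at_levelP=> xy xl yl; rewrite /delta; congr _.+1.
apply/eqP; rewrite eqn_leq; apply/andP; split.
  by rewrite -minEnat; apply: (@bigmin_le_cond _ nat 'I_d); rewrite xl yl.
rewrite -minEnat; apply: (@le_bigmin _ nat 'I_d); first exact: ltnW.
move=> j; apply: contraNT; rewrite -ltNge => jl; apply/eqP; exact: xy.
Qed.

Lemma lexlt_delta (d : nat) (l : 'I_d) (x y : cube d) :
  lexlt x y -> (delta x y == l.+1) = at_level l x y.
Proof.
case/lexltP=> m xym; apply/eqP/idP => [|/at_level_delta //].
by rewrite (at_level_delta xym) => -[/val_inj <-].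
Qed.

Lemma delta_le (d : nat) (x y : cube d) : (delta x y <= d.+1)%N.
Proof. by rewrite ltnS -minEnat; apply: (@bigmin_le_id _ nat). Qed.

Lemma lexlt_irr (d : nat) (x : cube d) : lexlt x x = false.
Proof.
by apply/negbTE/negP => /lexltP[l /at_levelP[_ -> ]].
Qed.

Lemma lexlt_trans (d : nat) : transitive (@lexlt d).
Proof.
move=> y x z /lexltP[l /at_levelP[xy xl yl]] /lexltP[m /at_levelP[yz ym zm]].
apply/lexltP; case: (ltngtP l m) => [lm|ml|/val_inj lm].
- exists l; apply/at_levelP; split=> // [j jl|]; last by rewrite -yz.
  by rewrite xy // yz // (ltn_trans jl).
- exists m; apply/at_levelP; split=> // [j jm|]; last by rewrite xy.
  by rewrite xy ?yz // (ltn_trans jm).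
- by rewrite lm ym in yl.
Qed.

Lemma lexlt_total (d : nat) (x y : cube d) :
  x != y -> lexlt x y || lexlt y x.
Proof.
move=> nxy; have [i0 xyi0] : exists i, x i != y i.
  apply/existsP; apply: contraNT nxy => /existsPn xy.
  by apply/eqP/ffunP => i; apply/eqP; have := xy i; rewrite negbK.
have [l xyl min] := @arg_minnP _ i0 (fun i => x i != y i) val xyi0.
have eqj (j : 'I_d) : (j < l)%N -> x j = y j.
  by move=> jl; apply/eqP; apply: contraLR jl => /min; rewrite -leqNgt.
case xlE: (x l); case ylE: (y l); rewrite xlE ylE // in xyl.
  by apply/orP; right; apply/lexltP; exists l; apply/at_levelP; split=> // j /eqj.
by apply/orP; left; apply/lexltP; exists l; apply/at_levelP.
Qed.

Definition lexrank (d : nat) (x : cube d) : nat := #|[set u | lexlt u x]|.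

Lemma lexlt_rank (d : nat) (x y : cube d) : lexlt x y = (lexrank x < lexrank y)%N.
Proof.
have mono (a b : cube d) : lexlt a b -> (lexrank a < lexrank b)%N.
  move=> ab; apply/proper_card/properP; split.
    by apply/fintype.subsetP => u; rewrite !inE => /lexlt_trans; apply.
  by exists a; rewrite !inE ?lexlt_irr.
apply/idP/idP => [/mono //|]; apply: contraTT => nxy.
have [->|/lexlt_total] := eqVneq x y; first by rewrite ltnn.
by rewrite (negbTE nxy) /= => /mono yx; rewrite -leqNgt ltnW.
Qed.

Lemma lexrank_inj (d : nat) : injective (@lexrank d).
Proof.
move=> x y xy; apply/eqP; apply: contraT => /lexlt_total.
by rewrite !lexlt_rank xy ltnn.
Qed.

(** * Sampling the pairs of a level *)

Definition setb (d : nat) (y : cube d) (l : 'I_d) (v : bool) : cube d :=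
  [ffun c => if c == l then v else y c].

(** Together with [setb y l true] this parametrizes the pairs of level [l]: [y] supplies the common
    prefix and the tail of the larger vertex, [t] the tail of the smaller one. *)
Definition splice (d : nat) (y : cube d) (l : 'I_d) (t : cube d) : cube d :=
  [ffun c : 'I_d => if (c < l)%N then y c else if c == l then false else t c].

Lemma at_level_splice (d : nat) (y : cube d) (l : 'I_d) (t : cube d) :
  at_level l (splice y l t) (setb y l true).
Proof.
apply/at_levelP; split; rewrite ?ffunE ?ltnn ?eqxx // => j jl.
by rewrite !ffunE jl; case: eqP jl => // ->; rewrite ltnn.
Qed.

Lemma card_agree (d : nat) (x : cube d) (P : pred 'I_d) :
  (\sum_(t : cube d) [forall c, P c ==> (t c == x c)] = 2 ^ #|predC P|)%N.
Proof.
transitivity (\sum_(t : cube d) \prod_(c : 'I_d) (P c ==> (t c == x c)))%N.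
  apply: eq_bigr => t _.
  case: forallP => [h|/forallP]; first by rewrite big1 // => c _; rewrite h.
  by case/forallPn=> c /negbTE h; rewrite (bigD1 c) //= h mul0n.
rewrite -(bigA_distr_bigA (fun c b => nat_of_bool (P c ==> (b == x c)))) /=.
rewrite -prod_nat_const [RHS]big_mkcond /=; apply: eq_bigr => c _.
by rewrite big_bool !inE /=; case: (P c); case: (x c).
Qed.

Lemma card_ord_gt (d : nat) (m : 'I_d) : #|predC (fun c : 'I_d => (m < c)%N)| = m.+1.
Proof.
rewrite -sum1_card (eq_bigl (fun c : 'I_d => (c < m.+1)%N)); last first.
  by move=> c; rewrite !inE -leqNgt.
by rewrite -(big_ord_widen d (fun=> 1%N)) // sum1_card card_ord.
Qed.

(** The pair [p] determines [y] except at [l], and [t] beyond [l]. One bit of [y] and [l.+1] bits of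
    [t] remain free. *)
Lemma card_fiber (d : nat) (l : 'I_d) (p : cube d * cube d) :
  at_level l p.1 p.2 ->
  (\sum_(y : cube d) \sum_(t : cube d)
     (p == (splice y l t, setb y l true)) = 2 ^ l.+2)%N.
Proof.
case: p => x z /= /at_levelP[xz xl zl].
transitivity (\sum_(y : cube d) \sum_(t : cube d)
   ([forall c, (c != l) ==> (y c == z c)]
     * [forall c : 'I_d, (l < c)%N ==> (t c == x c)]))%N.
  apply: eq_bigr => y _; apply: eq_bigr => t _.
  rewrite mulnb; congr nat_of_bool; apply/eqP/andP.
    case=> xE zE; split; apply/forallP => c; apply/implyP => cl.
      by rewrite zE ffunE (negbTE cl).
    rewrite xE ffunE ltnNge ltnW //= ifN //.
    by apply: contraTneq cl => ->; rewrite ltnn.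
  case=> /forallP yz /forallP tx; congr (_, _); apply/ffunP=> c; rewrite ffunE.
    case: (ltngtP c l) => [cl|lc|/val_inj ->]; last by rewrite eqxx.
      rewrite xz //; apply/esym/eqP/(implyP (yz c)).
      by apply: contraTneq cl => ->; rewrite ltnn.
    rewrite ifN; first by apply/esym/eqP/(implyP (tx c)).
    by apply: contraTneq lc => ->; rewrite ltnn.
  case: eqVneq => [->//|cl]; exact/esym/eqP/(implyP (yz c)).
under eq_bigr do rewrite -big_distrr.
rewrite -big_distrl /= !card_agree card_ord_gt (_ : #|_| = 1%N); last first.
  by rewrite (eq_card (B := pred1 l)) ?card1 // => c; rewrite !inE negbK.
by rewrite expnS.
Qed.

Lemma card_level (d : nat) (G : cgraph d) (l : 'I_d) : is_cgraph G ->
  (\sum_(y : cube d) \sum_(t : cube d) ((splice y l t, setb y l true) \in G)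
   = e_level G l.+1 * 2 ^ l.+2)%N.
Proof.
move=> /forallP Gwf.
have Glt p : p \in G -> lexlt p.1 p.2 by move=> pG; exact: (implyP (Gwf p)).
rewrite /e_level -sum_nat_const.
under [RHS]eq_bigr => p.
  rewrite inE => /andP[pG]; rewrite lexlt_delta ?Glt // => /card_fiber <-; over.
rewrite /= [RHS]exchange_big; apply: eq_bigr => y _ /=.
rewrite [RHS]exchange_big; apply: eq_bigr => t _ /=.
set q := (splice y l t, setb y l true).
case: (boolP (q \in G)) => qG; last first.
  rewrite big1 // => p; rewrite inE => /andP[pG _].
  by case: eqP => // pq; rewrite -pq pG in qG.
rewrite (bigD1 q) /= ?eqxx; last first.
  by rewrite inE qG lexlt_delta ?Glt // at_level_splice.
by rewrite big1 // => p /andP[_ /negbTE ->].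
Qed.

(** * Averages and planted bits *)

Definition avg (R : realType) (I : finType) (f : I -> R) : R :=
  (\sum_i f i) / #|I|%:R.

Section Avg.
Variables (R : realType) (I J : finType).
Implicit Types f g : I -> R.

Lemma eq_avg f g : f =1 g -> avg f = avg g.
Proof. by move=> fg; congr (_ / _); apply: eq_bigr. Qed.

Lemma le_avg f g : (forall i, f i <= g i) -> avg f <= avg g.
Proof. by move=> fg; rewrite ler_wpM2r ?invr_ge0 ?ler0n // ler_sum. Qed.

Lemma avg_const (c : R) : (0 < #|I|)%N -> avg (fun _ : I => c) = c.
Proof.
by move=> I0; rewrite /avg sumr_const -[c *+ _]mulr_natr mulfK // pnatr_eq0 -lt0n.
Qed.

Lemma avgB f (c : R) : (0 < #|I|)%N -> avg (fun i => f i - c) = avg f - c.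
Proof.
by move=> I0; rewrite -{2}(avg_const c I0) /avg -mulrBl -sumrB.
Qed.

Lemma avg_itv f : (0 < #|I|)%N -> (forall i, 0 <= f i <= 1) -> 0 <= avg f <= 1.
Proof.
move=> I0 f01; rewrite -(avg_const 1 I0) le_avg ?andbT; last first.
  by move=> i; case/andP: (f01 i).
by rewrite -(avg_const 0 I0) le_avg // => i; case/andP: (f01 i).
Qed.

Lemma avg_exchange (F : I -> J -> R) :
  avg (fun i => avg (F i)) = avg (fun j => avg (F^~ j)).
Proof.
by rewrite /avg -!mulr_suml mulrAC exchange_big.
Qed.

Lemma avg_pair (F : I -> J -> R) :
  avg (fun p : I * J => F p.1 p.2) = avg (fun i => avg (F i)).
Proof.
by rewrite /avg -mulr_suml pair_bigA card_prod natrM invfM mulrA mulrAC.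
Qed.

Lemma avg_sum (A : {pred J}) (F : J -> I -> R) :
  avg (fun i => \sum_(j in A) F j i) = \sum_(j in A) avg (F j).
Proof. by rewrite /avg exchange_big mulr_suml. Qed.

Lemma avg_gt f (c : R) : (0 < #|I|)%N -> c < avg f -> exists i, c < f i.
Proof.
move=> I0 cf; apply/existsP; apply: contraLR cf => /existsPn fc.
by rewrite -leNgt -[leRHS](avg_const c I0) le_avg // => i; rewrite leNgt.
Qed.

End Avg.

Lemma card_cube_gt0 (d : nat) : (0 < #|cube d|)%N.
Proof. by apply/card_gt0P; exists [ffun=> false]. Qed.

Lemma setb_id (d : nat) (y : cube d) (l : 'I_d) (v : bool) :
  y l = v -> setb y l v = y.
Proof. by move=> yl; apply/ffunP => c; rewrite ffunE; case: eqP => // ->. Qed.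

Definition flip (d : nat) (l : 'I_d) (y : cube d) : cube d := setb y l (~~ y l).

Lemma flipK (d : nat) (l : 'I_d) : involutive (flip l).
Proof.
move=> y; apply/ffunP => c; rewrite !ffunE eqxx negbK.
by case: eqP => // ->.
Qed.

(** Forcing a bit maps the cube two-to-one onto a half cube, so the uniform measure acquires density
    2 on that half and 0 on the other. *)
Lemma sum_setb (R : realType) (d : nat) (h : cube d -> R) (l : 'I_d) (v : bool) :
  \sum_y h (setb y l v) = \sum_y (2 * ((y : cube d) l == v)%:R) * h y.
Proof.
have half (g : cube d -> R) : \sum_(y : cube d | y l != v) g (setb y l v) =
    \sum_(y : cube d | y l == v) g y.
  rewrite (reindex_inj (inv_inj (flipK l))) /=; apply: eq_big => y.
    by rewrite ffunE eqxx; case: (y l); case: v.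
  rewrite ffunE eqxx => yl; congr g; apply/ffunP => c; rewrite !ffunE.
  by case: eqP => // ->; move: yl; case: (y l); case: v.
rewrite (bigID (fun y : cube d => y l == v)) /= half.
rewrite [RHS](bigID (fun y : cube d => y l == v)) /= addrC.
rewrite [X in _ = _ + X]big1 ?addr0 => [|y /negbTE ->]; last by rewrite mulr0 mul0r.
rewrite -big_split /=; apply: eq_bigr => y /eqP yl.
by rewrite setb_id // yl eqxx mulr1 mulrDl mul1r.
Qed.

Definition sgnb (R : realType) (d : nat) (v : bool) (l : 'I_d) (y : cube d) : R :=
  2 * (y l == v)%:R - 1.

Lemma sum_sgnb_mul (R : realType) (d : nat) (v : bool) (l m : 'I_d) :
  \sum_(y : cube d) sgnb R v l y * sgnb R v m y = (l == m)%:R * #|cube d|%:R.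
Proof.
have sq (b : bool) : (2 * b%:R - 1 : R) * (2 * b%:R - 1) = 1 by case: b => /=; ring.
case: eqVneq => [->|lm].
  under eq_bigr do rewrite /sgnb sq.
  by rewrite sumr_const mul1r.
(* For distinct levels, flipping bit [l] negates exactly one factor, so the sum equals its own
   negative. *)
rewrite mul0r; apply/eqP; rewrite -[_ == 0](mulrn_eq0 _ 2) /= mulr2n.
rewrite {1}(reindex_inj (inv_inj (flipK l))) /= -big_split big1 //= => y _.
rewrite /sgnb !ffunE eqxx [m == l]eq_sym (negbTE lm).
by case: (y l); case: v => /=; ring.
Qed.

(* Planting the bit [v] at a random level of the block tilts the uniform measure
   by [1 + X], where [X] is an average of pairwise orthogonal signs and thus has
   variance [1 / b.+1]. *)
Lemma avg_plant (R : realType) (d b : nat) (e : R) (L : 'I_b.+1 -> 'I_d)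
    (v : bool) (h : cube d -> R) :
  0 < e -> 4 <= e ^+ 2 * b.+1%:R -> injective L ->
  (forall y, 0 <= h y <= 1) ->
  avg h - e <= avg (fun y => avg (fun a => h (setb y (L a) v))).
Proof.
move=> e0 eb Linj h01; pose X y := avg (fun a => sgnb R v (L a) y).
have b0 : b.+1%:R != 0 :> R by rewrite pnatr_eq0.
have X2 : \sum_y X y ^+ 2 = #|cube d|%:R / b.+1%:R.
  have XE y : X y ^+ 2 = (\sum_a \sum_c sgnb R v (L a) y * sgnb R v (L c) y)
      / (b.+1%:R * b.+1%:R).
    rewrite /X /avg card_ord expr2 mulrACA -invfM big_distrlr /=; congr (_ / _).
  under eq_bigr do rewrite XE.
  rewrite -mulr_suml exchange_big /=.
  under eq_bigr do rewrite exchange_big /=.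
  under eq_bigr => a _ do under eq_bigr do rewrite sum_sgnb_mul (inj_eq Linj).
  under eq_bigr => a _.
    rewrite -mulr_suml (bigD1 a) //= eqxx big1 ?addr0 ?mul1r; last first.
      by move=> c /negbTE; rewrite eq_sym => ->.
    over.
  by rewrite sumr_const card_ord -[_ *+ _]mulr_natr; move: (b.+1%:R) b0 => B B0; field.
have -> : avg (fun y => avg (fun a => h (setb y (L a) v))) =
          avg (fun y => h y + X y * h y).
  rewrite avg_exchange /avg -mulr_suml.
  under eq_bigr do rewrite sum_setb.
  rewrite exchange_big /= mulrAC; congr (_ / _).
  rewrite mulr_suml; apply: eq_bigr => y _; rewrite -mulr_suml /X /avg /sgnb.
  by rewrite sumrB sumr_const card_ord; move: (b.+1%:R) b0 => B B0; field.
have [N N0] : exists N : R, N = #|cube d|%:R /\ 0 < N.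
  by exists #|cube d|%:R; rewrite ltr0n card_cube_gt0.
(* A quadratic bound on [|X y|] stands in for Cauchy-Schwarz: after averaging, only the second
   moment [X2] enters, and the hypothesis [4 <= e ^+ 2 * b.+1%:R] makes its contribution at most
   [e / 2]. *)
have le y : h y - (e / 2 + (2 / e) * X y ^+ 2) <= h y + X y * h y.
  have /andP[h0 h1] := h01 y.
  suff: - (X y * h y) <= e / 2 + (2 / e) * X y ^+ 2 by lra.
  have: `|X y| <= e / 2 + (2 / e) * X y ^+ 2.
    have -> : (2 / e) * X y ^+ 2 = `|X y| ^+ 2 * 2 / e.
      by rewrite real_normK ?num_real //; field; rewrite gt_eqF.
    set x := `|X y|; have x0 : 0 <= x by exact: normr_ge0.
    have -> : e / 2 + x ^+ 2 * 2 / e = (e ^+ 2 + 4 * x ^+ 2) / (2 * e).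
      by field; rewrite gt_eqF.
    rewrite ler_pdivlMr ?mulr_gt0 //; nra.
  apply: le_trans; rewrite -mulNr -normrN.
  have := ler_norm (- X y); have := normr_ge0 (- X y); nra.
apply: le_trans (le_avg le).
case: N0 => NE N0; rewrite /avg sumrB big_split /= sumr_const -mulr_sumr X2 -NE.
rewrite -[_ *+ _]mulr_natr -NE mulrBl lerD2l lerN2.
have B0 : 0 < b.+1%:R :> R by rewrite ltr0n.
move: (b.+1%:R) eb B0 => B eb B0.
have -> : (e / 2 * N + 2 / e * (N / B)) / N = e / 2 + 2 / (e * B).
  by field; rewrite !gt_eqF.
suff: 2 / (e * B) <= e / 2 by lra.
rewrite ler_pdivrMr ?mulr_gt0 //.
have -> : e / 2 * (e * B) = e ^+ 2 * B / 2 by field.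
by lra.
Qed.

(** * Random caterpillars *)

Definition level_avg (R : realType) (d : nat) (l : 'I_d)
    (f : cube d -> cube d -> R) : R :=
  avg (fun y => avg (fun t => f (splice y l t) (setb y l true))).

(** Exchanging the tails of [y] and [t] beyond [l] preserves the uniform measure, so a spliced
    vertex is distributed like a uniform vertex with bit [l] cleared. *)
Lemma avg_splice (R : realType) (d : nat) (l : 'I_d) (h : cube d -> R) :
  avg (fun y => avg (fun t => h (splice y l t))) = avg (fun y => h (setb y l false)).
Proof.
pose mix (y t : cube d) : cube d := [ffun c : 'I_d => if (c <= l)%N then y c else t c].
pose sw (p : cube d * cube d) := (mix p.1 p.2, mix p.2 p.1).
have swK : involutive sw.
  by case=> y t; congr (_, _); apply/ffunP => c; rewrite !ffunE; case: leqP.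
rewrite -[LHS]avg_pair.
transitivity (avg (fun p : cube d * cube d => h (setb p.1 l false))).
  rewrite /avg; congr (_ / _); rewrite [RHS](reindex_inj (inv_inj swK)) /=.
  apply: eq_bigr => -[y t] _ /=; congr h; apply/ffunP => c; rewrite !ffunE.
  case: (ltngtP c l) => [cl|lc|/val_inj ->]; last by rewrite eqxx.
    by case: eqP cl => // ->; rewrite ltnn.
  by case: eqP lc => // ->; rewrite ltnn.
rewrite (avg_pair (fun y _ => h (setb y l false))).
by apply: eq_avg => y; rewrite avg_const ?card_cube_gt0.
Qed.

Lemma setb_splice (d : nat) (y t : cube d) (l m : 'I_d) (v : bool) :
  (l < m)%N -> setb (splice y m t) l v = splice (setb y l v) m t.
Proof.
move=> lm; apply/ffunP => c; rewrite !ffunE.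
by case: (c =P l) => [->|_]; rewrite ?lm.
Qed.

Lemma setbC (d : nat) (y : cube d) (l m : 'I_d) (u v : bool) :
  l != m -> setb (setb y m u) l v = setb (setb y l v) m u.
Proof.
move=> lm; apply/ffunP => c; rewrite !ffunE.
by case: (c =P l) => [->|//]; rewrite (negbTE lm).
Qed.

Lemma lexlt_setb (d : nat) (x y : cube d) (l : 'I_d) :
  x l = y l -> lexlt x y -> lexlt (setb x l true) (setb y l true).
Proof.
move=> xyl /lexltP[m /at_levelP[xy xm ym]]; apply/lexltP; exists m.
have ml : (m == l) = false.
  by apply/eqP => ml; move: xyl; rewrite -ml xm ym.
apply/at_levelP; split; rewrite ?ffunE ?ml // => j jm; rewrite !ffunE.
by case: ifP => // _; exact: xy.
Qed.

Lemma splice_agree (d : nat) (x y : cube d) (l : 'I_d) (t : cube d) :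
  (forall c : 'I_d, (c < l)%N -> x c = y c) -> splice x l t = splice y l t.
Proof. by move=> xy; apply/ffunP => c; rewrite !ffunE; case: ifP => // /xy. Qed.

(* The vertices [0 .. n] hang off a random spine: vertex [i] leaves it to the left
   at a random level of the [i]-th block.  The spine has to go right at the chosen
   levels, which by [avg_plant] costs [e] per block. *)
Lemma caterpillar (R : realType) (d b : nat) (e : R) (n : nat)
    (L : nat -> 'I_b.+1 -> 'I_d) :
  0 < e -> 4 <= e ^+ 2 * b.+1%:R ->
  (forall k, (k < n)%N -> injective (L k)) ->
  (forall k k' a a', (k < k' < n)%N -> (L k a < L k' a')%N) ->
  exists (I : finType) (phi : I -> nat -> cube d),
  [/\ (0 < #|I|)%N,
      forall w i j, (i < j <= n)%N -> lexlt (phi w i) (phi w j),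
      forall w i j (c : 'I_d), (i <= n)%N -> (j <= n)%N ->
        (forall k a, (k < n)%N -> (c < L k a)%N) -> phi w i c = phi w j c,
      forall h i, (i <= n)%N -> (forall y, 0 <= h y <= 1) ->
        avg h - n%:R * e <= avg (fun w => h (phi w i))
    & forall f i j, (i < j <= n)%N -> (forall x y, 0 <= f x y <= 1) ->
        avg (fun a => level_avg (L i a) f) - n%:R * e <=
        avg (fun w => f (phi w i) (phi w j))].
Proof.
move=> e0 eb; have C0 := card_cube_gt0 d.
have B0 : (0 < #|'I_b.+1|)%N by rewrite card_ord.
have ne0 m : 0 <= m%:R * e by rewrite mulr_ge0 ?ler0n // ltW.
elim: n L => [|n IH] L Linj Llt.
  exists (cube d : finType), (fun w _ => w); split=> //.
  - by move=> w i j; case: j => [|j]; rewrite ?andbF // ltn0.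
  - by move=> h i _ _; rewrite mul0r subr0.
  - by move=> f i j; case: j => [|j]; rewrite ?andbF // ltn0.
have [||I [phi [I0 phi_lt phi_eq phi1 phi2]]] := IH (fun k => L k.+1).
- by move=> k kn; apply: Linj.
- by move=> k k' a a' kk'; apply: Llt.
have L0inj : injective (L 0) by apply: Linj.
(* Later blocks lie strictly deeper, so all vertices of the smaller caterpillar share their
   coordinates up to and including [L 0 a]. *)
have agree w i j a (c : 'I_d) : (i <= n)%N -> (j <= n)%N -> (c <= L 0 a)%N ->
    phi w i c = phi w j c.
  move=> ni nj ca; apply: phi_eq => // k a' kn.
  by apply: leq_ltn_trans ca _; apply: Llt.
(* Block 0 goes on top of the smaller caterpillar: the new vertex 0 gets bit 0 at the chosen level
   and a fresh tail, while the old vertices move up by one index and get bit 1. *)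
pose phi' (w : I * 'I_b.+1 * cube d) i :=
  if i is j.+1 then setb (phi w.1.1 j) (L 0 w.1.2) true
  else splice (phi w.1.1 0) (L 0 w.1.2) w.2.
have avg3 (F : I -> 'I_b.+1 -> cube d -> R) :
    avg (fun w : I * 'I_b.+1 * cube d => F w.1.1 w.1.2 w.2) =
    avg (fun w => avg (fun a => avg (F w a))).
  rewrite (avg_pair (fun p t => F p.1 p.2 t)).
  exact: (avg_pair (fun w a => avg (F w a))).
exists (I * 'I_b.+1 * cube d)%type, phi'; split.
- by rewrite !card_prod !muln_gt0 I0 B0 C0.
- move=> [[w a] t] [|i] [|j] //= ij; last first.
    apply: lexlt_setb; last exact: phi_lt.
    by apply: (agree w i j a) => //; lia.
  rewrite (@splice_agree _ _ (phi w j)) => [|c ca].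
    by apply/lexltP; exists (L 0 a); apply: at_level_splice.
  by apply: (agree w 0 j a) => //; exact: ltnW.
- move=> [[w a] t] i j c ni nj cL.
  have ca : (c < L 0 a)%N by apply: cL.
  have {cL} ph i' j' : (i' <= n)%N -> (j' <= n)%N -> phi w i' c = phi w j' c.
    by move=> ni' nj'; apply: (agree w i' j' a) => //; apply: ltnW.
  have ncl : (c == L 0 a) = false by apply/eqP => cl; rewrite cl ltnn in ca.
  by case: i j ni nj => [|i] [|j] ni nj /=; rewrite !ffunE ?ca ?ncl //; apply: ph.
- move=> h i ni h01.
  (* The choices made in block 0 are absorbed into a new test function [g]: planting the bit costs
     one [e], and the induction hypothesis the other [n%:R * e]. *)
  suff [g [g01 gE hg]] : exists g : cube d -> R, [/\ forall y, 0 <= g y <= 1,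
      avg (fun w => h (phi' w i)) = avg (fun w => g (phi w i.-1))
    & avg h - e <= avg g].
    rewrite gE; apply: le_trans (phi1 g i.-1 _ g01); last by lia.
    by rewrite -natr1 mulrDl mul1r; lra.
  case: i ni => [|i] ni.
    exists (fun z => avg (fun a => avg (fun t => h (splice z (L 0 a) t)))); split.
    + by move=> y; apply: avg_itv => // a; apply: avg_itv.
    + by rewrite (avg3 (fun w a t => h (splice (phi w 0) (L 0 a) t))).
    + rewrite avg_exchange; under [leRHS]eq_avg do rewrite avg_splice.
      by rewrite -avg_exchange; apply: avg_plant.
  exists (fun z => avg (fun a => h (setb z (L 0 a) true))); split.
  + by move=> y; apply: avg_itv.
  + rewrite (avg3 (fun w a t => h (setb (phi w i) (L 0 a) true))).
    by apply: eq_avg => w; apply: eq_avg => a; rewrite avg_const.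
  + exact: avg_plant.
move=> f [|i] [|j] //= ij f01.
  (* Vertex 0 against a later one: [phi w 0] and [phi w j] agree before [L 0 a], so the pair is a
     level sample driven by [phi w j] alone, and the one-vertex bound [phi1] suffices. *)
  pose g z := avg (fun a => avg (fun t => f (splice z (L 0 a) t) (setb z (L 0 a) true))).
  have g01 y : 0 <= g y <= 1 by apply: avg_itv => // a; apply: avg_itv.
  have -> : avg (fun w => f (phi' w 0) (phi' w j.+1)) = avg (fun w => g (phi w j)).
    rewrite (avg3 (fun w a t => f (splice (phi w 0) (L 0 a) t) (setb (phi w j) (L 0 a) true))).
    apply: eq_avg => w; apply: eq_avg => a; apply: eq_avg => t; congr f.
    by apply: splice_agree => c ca; apply: (agree w 0 j a) => //; exact: ltnW.
  apply: le_trans (phi1 g j _ g01); last by lia.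
  by rewrite /g avg_exchange -natr1 mulrDl; lra.
(* Two later vertices branch in a deeper block, where planting a bit of block 0 commutes with
   [splice] and [setb]. The planting therefore acts on the variable [y] of [level_avg], at the price
   of one more [e]. *)
pose g x y := avg (fun a => f (setb x (L 0 a) true) (setb y (L 0 a) true)).
have g01 x y : 0 <= g x y <= 1 by apply: avg_itv.
have -> : avg (fun w => f (phi' w i.+1) (phi' w j.+1)) =
          avg (fun w => g (phi w i) (phi w j)).
  rewrite (avg3 (fun w a t => f (setb (phi w i) (L 0 a) true)
                                (setb (phi w j) (L 0 a) true))).
  by apply: eq_avg => w; apply: eq_avg => a; rewrite avg_const.
apply: le_trans (phi2 g i j ij g01).
rewrite -natr1 mulrDl mul1r opprD [- _ - e]addrC addrA lerD2r -avgB //.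
apply: le_avg => a'; rewrite /level_avg.
rewrite avg_exchange -avgB // [leRHS]avg_exchange; apply: le_avg => t.
set m := L i.+1 a'.
have lm a : (L 0 a < m)%N by apply: Llt; lia.
apply: le_trans (_ : _ <= avg (fun y => avg (fun a =>
   (fun z => f (splice z m t) (setb z m true)) (setb y (L 0 a) true)))) _.
  exact: avg_plant.
rewrite le_eqVlt; apply/orP; left; apply/eqP; apply: eq_avg => y; apply: eq_avg => a /=.
rewrite setb_splice // [in RHS]setbC //.
by apply/eqP => lmE; have := lm a; rewrite lmE ltnn.
Qed.

(** * Hosts inside graphs with many rich levels *)

Lemma containsR_map (k : nat) (F : ograph k) (V V' : finType) (lt : rel V)
    (lt' : rel V') (G : {set V * V}) (G' : {set V' * V'}) (g : V -> V') :
  (forall x y, lt x y -> lt' (g x) (g y)) ->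
  (forall x y, (x, y) \in G -> (g x, g y) \in G') ->
  containsR F lt G -> containsR F lt' G'.
Proof.
move=> glt gG /existsP[f /andP[/forallP fm /forallP fF]].
apply/existsP; exists [ffun i => g (f i)]; apply/andP; split; apply/forallP.
  move=> i; apply/forallP => j; apply/implyP => ij; rewrite !ffunE.
  by apply: glt; exact: (implyP (forallP (fm i) j)).
by move=> p; apply/implyP => pF; rewrite !ffunE; apply/gG/(implyP (fF p)).
Qed.

(** There are [tau l.+1 d * 2 ^ l.+2] samples [(y, t)], so the multiplicity in [card_level]
    cancels. *)
Lemma level_avg_graph (R : realType) (d : nat) (G : cgraph d) (l : 'I_d) :
  is_cgraph G ->
  level_avg l (fun x y => ((x, y) \in G)%:R : R) =
  (e_level G l.+1)%:R / (tau l.+1 d)%:R.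
Proof.
move=> Gwf; rewrite /level_avg /avg -mulr_suml.
have -> : \sum_y \sum_t ((splice y l t, setb y l true) \in G)%:R =
    (e_level G l.+1 * 2 ^ l.+2)%:R :> R.
  by rewrite -card_level // natr_sum; apply: eq_bigr => y _; rewrite natr_sum.
have cE : (#|cube d| * #|cube d| = tau l.+1 d * 2 ^ l.+2)%N.
  rewrite card_ffun card_bool card_ord /tau -!expnD; congr (_ ^ _)%N.
  by have := ltn_ord l; lia.
have q0 : (2 ^ l.+2)%:R != 0 :> R by rewrite pnatr_eq0 -lt0n expn_gt0.
rewrite -mulrA -invfM -natrM cE; move: (2 ^ l.+2)%N q0 => q q0.
by rewrite !natrM invfM mulrACA divff // mulr1.
Qed.

Lemma e_level_ratio_le1 (R : realType) (d : nat) (G : cgraph d) (l : 'I_d) :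
  is_cgraph G -> (e_level G l.+1)%:R / (tau l.+1 d)%:R <= 1 :> R.
Proof.
move=> Gwf.
have : 0 <= level_avg l (fun x y => ((x, y) \in G)%:R : R) <= 1.
  apply: avg_itv => [|y]; first exact: card_cube_gt0.
  apply: avg_itv => [|t]; first exact: card_cube_gt0.
  by case: (_ \in _); rewrite ?lexx ler01.
by rewrite level_avg_graph // => /andP[].
Qed.

(** Used to cut the increasing list of rich levels into consecutive blocks. *)
Lemma nth_enum_ord_ltn (d : nat) (A : {set 'I_d}) (l0 : 'I_d) (i j : nat) :
  (i < j < #|A|)%N -> (nth l0 (enum A) i < nth l0 (enum A) j)%N.
Proof.
case/andP=> ij jA.
have tr : transitive (fun x y : 'I_d => (x < y)%N) by move=> y x z; apply: ltn_trans.
apply: (sorted_ltn_nth tr); rewrite ?inE -?cardE //; last exact: ltn_trans ij jA.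
rewrite /enum_mem; apply: sorted_filter => //.
have := iota_ltn_sorted 0 d; rewrite -val_enum_ord sorted_map.
by rewrite enumT.
Qed.

Lemma rich_ccontains (R : realType) (k : nat) (F : ograph k) (n : nat)
    (G : ograph n) (g : R) :
  is_ograph G -> (0 < #|G|)%N -> rhoFG R F G < g ->
  exists C : nat, forall (d : nat) (H : cgraph d),
    is_cgraph H -> rich g C H -> ccontains F H.
Proof.
case: n G => [|n] G Gwf G0 rg.
  by case/card_gt0P: G0 => -[[]].
have Glt (p : 'I_n.+1 * 'I_n.+1) : p \in G -> (p.1 < p.2 <= n)%N.
  by move=> pG; rewrite -[(p.2 <= n)%N]ltnS ltn_ord andbT; exact: (implyP (forallP Gwf p)).
set r := rhoFG R F G in rg.
(* The total loss over [n] blocks has to stay strictly below the gap [g - r], hence the division by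
   [n.+1]. *)
pose e := (g - r) / n.+1%:R.
have n1 : 0 < n.+1%:R :> R by rewrite ltr0n.
have e0 : 0 < e by rewrite divr_gt0 // subr_gt0.
have ne : n%:R * e < g - r.
  have <- : n.+1%:R * e = g - r by rewrite /e mulrC divfK ?gt_eqF.
  by rewrite ltr_pM2r // ltr_nat.
pose b := Num.bound (4 / e ^+ 2).
have eb : 4 <= e ^+ 2 * b.+1%:R.
  rewrite mulrC -ler_pdivrMr ?exprn_gt0 //.
  have := @archi_boundP R (4 / e ^+ 2); rewrite divr_ge0 ?exprn_ge0 ?(ltW e0) //.
  by move=> /(_ isT) /ltW /le_trans; apply; rewrite ler_nat.
exists (n * b.+1)%N => d H Hwf; rewrite /rich; set A := [set l | _] => CA.
have n0 : (0 < n)%N by case/card_gt0P: G0 => p /Glt; lia.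
have [l0 _] : exists l0, l0 \in A.
  by apply/card_gt0P; apply: leq_trans CA; rewrite muln_gt0 n0.
pose L i (a : 'I_b.+1) := nth l0 (enum A) (i * b.+1 + a).
have idx i (a : 'I_b.+1) : (i < n)%N -> (i * b.+1 + a < #|A|)%N.
  move=> ni; apply: leq_trans CA; apply: leq_trans (_ : i.+1 * b.+1 <= _)%N.
    by rewrite mulSn addnC ltn_add2r.
  by rewrite leq_mul2r ni orbT.
have Linj i : (i < n)%N -> injective (L i).
  move=> ni a a' /eqP; rewrite nth_uniq ?enum_uniq -?cardE ?idx //.
  by rewrite eqn_add2l => /eqP/val_inj.
have Llt i i' a a' : (i < i' < n)%N -> (L i a < L i' a')%N.
  case/andP=> ii' ni'; apply: nth_enum_ord_ltn; rewrite idx // andbT.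
  apply: leq_trans (_ : i.+1 * b.+1 <= _)%N; first by rewrite mulSn addnC ltn_add2r.
  by apply: leq_trans (leq_addr _ _); rewrite leq_mul2r ii' orbT.
have [I [phi [I0 phi_lt _ _ phiH]]] := caterpillar e0 eb Linj Llt.
pose f (x y : cube d) : R := ((x, y) \in H)%:R.
have f01 x y : 0 <= f x y <= 1 by rewrite /f; case: (_ \in _); rewrite ?lexx ler01.
have dens p : p \in G -> g - n%:R * e <= avg (fun w => f (phi w p.1) (phi w p.2)).
  move=> /Glt pn; apply: le_trans (phiH f p.1 p.2 pn f01); rewrite lerD2r.
  rewrite -[leLHS](@avg_const R 'I_b.+1 g) ?card_ord //; apply: le_avg => a.
  rewrite level_avg_graph //.
  have : L p.1 a \in A.
    by rewrite -mem_enum mem_nth // -cardE idx //; case/andP: pn => /leq_trans; apply.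
  by rewrite inE /rich_level -ler_pdivlMr // ltr0n expn_gt0.
(* First moment: by [dens], the expected number of edges of [G] sent into [H] exceeds [#|G|%:R * r].
   The edges sent there by a good [w] are too many to form an [F]-free subgraph. *)
have [w rw] : exists w, #|G|%:R * r < \sum_(p in G) f (phi w p.1) (phi w p.2).
  apply: avg_gt => //; rewrite avg_sum.
  apply: lt_le_trans (ler_sum _ dens); rewrite sumr_const -[(_ - _) *+ _]mulr_natl.
  by rewrite ltr_pM2l ?ltr0n //; lra.
pose G' := [set p in G | (phi w p.1, phi w p.2) \in H].
have G'E : #|G'|%:R = \sum_(p in G) f (phi w p.1) (phi w p.2).
  rewrite -sum1_card natr_sum big_mkcond /= [RHS]big_mkcond; apply: eq_bigr => p _.
  by rewrite inE /f; case: (p \in G); case: (_ \in H).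
have : ocontains F G'.
  apply: contraLR rw => FG'; rewrite -G'E -leNgt mulrC -ler_pdivrMr ?ltr0n //.
  apply: (@le_bigmax_cond _ R _ 0 G' _ (fun G' : ograph n.+1 => #|G'|%:R / #|G|%:R)).
  by rewrite FG' andbT; apply/fintype.subsetP => p; rewrite inE => /andP[].
apply: (containsR_map (g := fun i : 'I_n.+1 => phi w i)) => [i j ij|i j].
  by apply: phi_lt; rewrite -[(j <= n)%N]ltnS ltn_ord andbT.
by rewrite inE => /andP[].
Qed.

(** * From weighted to unweighted hosts *)

(** Hosts in [rho] live on ordinals; [c] places [T] there, and the numbers it misses become isolated
    vertices. *)
Lemma rho_le_host (R : realType) (k : nat) (F : ograph k) (T : finType)
    (c : T -> nat) (E : {set T * T}) (a : R) :
  injective c -> (forall x y, (x, y) \in E -> (c x < c y)%N) ->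
  (0 < #|E|)%N -> 0 <= a ->
  (forall E' : {set T * T}, E' \subset E ->
     ~~ containsR F (fun x y => (c x < c y)%N) E' -> #|E'|%:R <= a * #|E|%:R) ->
  rho R F <= a.
Proof.
move=> cinj cE E0 a0 HE.
pose o t : 'I_(\max_t c t).+1 := inord (c t).
have oE t : o t = c t :> nat by rewrite inordK // ltnS leq_bigmax.
have oinj : injective o by move=> x y /(congr1 val) /=; rewrite !oE => /cinj.
pose oo (p : T * T) := (o p.1, o p.2).
have ooinj : injective oo by move=> [x y] [x' y'] [/oinj -> /oinj ->].
pose G : ograph _ := oo @: E.
apply: (@le_trans _ _ (rhoFG R F G)).
  apply: ge_inf; last first.
    exists (\max_t c t).+1, G; split=> //; last by rewrite card_imset.
    apply/forallP => p; apply/implyP => /imsetP[[x y] xyE ->].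
    by rewrite /ord_lt /= !oE cE.
  by exists 0 => _ [n [G' [_ _ ->]]]; apply: bigmax_ge_id.
apply: bigmax_le => // G' /andP[/fintype.subsetP G'G FG'].
rewrite card_imset // ler_pdivrMr ?ltr0n //.
pose E' := E :&: oo @^-1: G'.
have -> : G' = oo @: E'.
  apply/setP => p; apply/idP/imsetP => [pG'|[q]]; last first.
    by rewrite !inE => /andP[_ qG'] ->.
  have /imsetP[q qE pq] := G'G _ pG'.
  by exists q => //; rewrite !inE qE -pq.
rewrite card_imset //; apply: HE; first exact: subsetIl.
apply: contra FG'; apply: (containsR_map (g := o)) => [x y|x y].
  by rewrite /ord_lt !oE.
by rewrite !inE => /andP[].
Qed.

(* A weighted host [(V, W)] is simulated by an unweighted one on [V * Om], where
   [u : Om] assigns to each [y : V] a residue modulo [M.+1] and [(x, u)], [(y, v)]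
   are adjacent when [u y + v x < W x y], an event of density [W x y / M.+1].
   Distinct pairs [x, y] read distinct residues, so a uniformly random transversal
   clique contains all edges above a given pair [x, y] equally often. *)
Section Blowup.
Variables (V : finType) (lt : rel V) (W : V -> V -> nat) (M : nat).
Hypothesis lt_irr : irreflexive lt.
Hypothesis lt_trans : transitive lt.
Hypothesis W_gt0 : forall x y, (0 < W x y)%N.
Hypothesis W_le : forall x y, (W x y <= M.+1)%N.

Let Om := {ffun V -> 'I_M.+1}.
Let labelling := {ffun V -> Om}.

Definition compat (x y : V) (u v : Om) : bool := (val (u y + v x)%R < W x y)%N.

Definition clique (A : labelling) : bool :=
  [forall x, forall y, lt x y ==> compat x y (A x) (A y)].

Definition ncliques (x y : V) (u v : Om) : nat :=
  \sum_(A : labelling) [&& clique A, A x == u & A y == v].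

Lemma ncliques_const x y u v u' v' : lt x y ->
  compat x y u v -> compat x y u' v' -> ncliques x y u v = ncliques x y u' v'.
Proof.
move=> xy uv uv'.
have nyx : (y == x) = false by apply/eqP => yx; rewrite yx lt_irr in xy.
pose s := u' - u; pose t := v' - v.
have su : u + s = u' by rewrite addrC subrK.
have tv : v + t = v' by rewrite addrC subrK.
clearbody s t.
(* Translation by [D] moves the labels of [x] and [y] as required; its entries at the other vertices
   compensate, so [D a b + D b a] vanishes off the pair [x], [y] and all other adjacencies
   survive. *)
pose D : labelling := [ffun a => [ffun b =>
  if a == x then s b else if a == y then t b else
  if b == x then - s a else if b == y then - t a else 0]].
have DE a b : D a b = if a == x then s b else if a == y then t b else
  if b == x then - s a else if b == y then - t a else 0 by rewrite !ffunE.
have Dx : D x = s by apply/ffunP => b; rewrite DE eqxx.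
have Dy : D y = t by apply/ffunP => b; rewrite DE nyx eqxx.
have D0 a b : a != b -> (a, b) != (x, y) -> (a, b) != (y, x) -> D a b + D b a = 0.
  rewrite !DE !xpair_eqE.
  have [->|ax] := eqVneq a x.
    by rewrite eq_sym => /negbTE -> /= /negbTE ->; rewrite subrr.
  have [->|ay] := eqVneq a y.
    by rewrite eq_sym => /negbTE -> _ /= /negbTE ->; rewrite subrr.
  by case: (b == x); case: (b == y); rewrite ?addNr ?addr0.
rewrite /ncliques [RHS](reindex_inj (addIr D)) /=.
apply: eq_bigr => A _; congr nat_of_bool.
rewrite [(A + D) x]ffunE [(A + D) y]ffunE Dx Dy -su -tv !(inj_eq (addIr _)).
rewrite -su -tv in uv' *.
case: (A x =P u) => [Ax|]; last by rewrite !andbF.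
case: (A y =P v) => [Ay|]; last by rewrite !andbF.
rewrite !andbT; apply: eq_forallb => a; apply: eq_forallb => b.
case ab: (lt a b) => //=.
have nab : a != b by apply: contraTneq ab => ->; rewrite lt_irr.
have nayx : (a, b) != (y, x).
  apply: contraTneq ab => -[-> ->]; apply/negP => /(lt_trans xy).
  by rewrite lt_irr.
have [[-> ->]|naxy] := eqVneq (a, b) (x, y).
  by rewrite [(A + D) x]ffunE [(A + D) y]ffunE Dx Dy Ax Ay uv uv'.
rewrite /compat; congr (val _ < _)%N.
rewrite [(A + D) a]ffunE [(A + D) b]ffunE [(A a + D a) b]ffunE [(A b + D b) a]ffunE.
by rewrite addrACA D0 // addr0.
Qed.

(** Adding a constant to [u] shifts [u y + v x], so all [M.+1] residues are equally frequent, and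
    [W x y] of them are accepted. *)
Lemma card_compat x y : x != y ->
  (#|[set w : Om * Om | compat x y w.1 w.2]| * M.+1 = W x y * #|Om| ^ 2)%N.
Proof.
move=> xy.
pose S (a : 'I_M.+1) := (\sum_(w : Om * Om) (val (w.1 y + w.2 x + a)%R < W x y))%N.
have S0 a : S a = #|[set w : Om * Om | compat x y w.1 w.2]|.
  pose h (w : Om * Om) := (w.1 + [ffun=> a], w.2).
  have hinj : injective h by move=> [u v] [u' v'] [/addIr -> ->].
  rewrite -sum1_card [RHS]big_mkcond [RHS](reindex_inj hinj) /=.
  apply: eq_bigr => w _; rewrite inE /compat.
  rewrite (_ : (h w).1 y + (h w).2 x = w.1 y + w.2 x + a); last first.
    by rewrite !ffunE addrAC.
  by case: (_ < _)%N.
transitivity (\sum_a S a)%N.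
  by under eq_bigr do rewrite S0; rewrite sum_nat_const card_ord mulnC.
rewrite exchange_big.
have -> : (#|Om| ^ 2 = #|{: Om * Om}|)%N by rewrite card_prod mulnn.
rewrite mulnC -sum_nat_const; apply: eq_bigr => w _.
rewrite -[RHS]card_ord -[RHS]sum1_card (big_ord_widen _ (fun=> 1%N) (W_le x y)).
rewrite [RHS]big_mkcond [LHS](reindex_inj (addrI (- (w.1 y + w.2 x)))).
by apply: eq_bigr => a _; rewrite addNKr; case: (_ < _)%N.
Qed.

(** Each clique uses exactly one compatible pair of labels above [x], [y], and all such pairs are
    used equally often; [card_compat] gives their number. *)
Lemma ncliquesE x y u v : lt x y -> compat x y u v ->
  (W x y * ncliques x y u v * #|Om| ^ 2 = #|[set A | clique A]| * M.+1)%N.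
Proof.
move=> xy uv; have nxy : x != y by apply: contraTneq xy => ->; rewrite lt_irr.
rewrite mulnAC -card_compat // mulnAC; congr (_ * _)%N.
rewrite -sum_nat_const.
transitivity (\sum_(w in [set w : Om * Om | compat x y w.1 w.2])
   ncliques x y w.1 w.2)%N.
  by apply: eq_bigr => w; rewrite inE => /(ncliques_const xy uv).
rewrite /ncliques exchange_big -sum1_card [RHS]big_mkcond /=.
apply: eq_bigr => A _; rewrite inE.
case: ifPn => [clA|nclA]; last by rewrite big1.
rewrite (bigD1 (A x, A y)) /= ?inE /=; last first.
  exact: (implyP (forallP (forallP clA x) y)).
rewrite !eqxx big1 // => -[u' v'] /=; rewrite xpair_eqE => /andP[_].
by rewrite negb_and ![_ == A _]eq_sym => /orP[] /negbTE ->; rewrite ?andbF.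
Qed.

Definition blowup : {set (V * Om) * (V * Om)} :=
  [set q | lt q.1.1 q.2.1 && compat q.1.1 q.2.1 q.1.2 q.2.2].

Definition trace (A : labelling) (E : {set (V * Om) * (V * Om)}) : {set V * V} :=
  [set p | ((p.1, A p.1), (p.2, A p.2)) \in E].

(** By [ncliquesE] the weight of an edge offsets how often cliques see it, so the total trace weight
    is proportional to [#|E|]. *)
Lemma sum_trace (E : {set (V * Om) * (V * Om)}) : E \subset blowup ->
  ((\sum_(A | clique A) \sum_(p in trace A E) W p.1 p.2) * #|Om| ^ 2
   = #|E| * (#|[set A | clique A]| * M.+1))%N.
Proof.
move=> /fintype.subsetP EB; rewrite -sum_nat_const.
under [RHS]eq_bigr => q qE.
  have := EB _ qE; rewrite inE => /andP[/ncliquesE ql /ql <-]; over.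
rewrite /= -big_distrl /=; congr (_ * _)%N.
under [RHS]eq_bigr do rewrite big_distrr.
rewrite [RHS]exchange_big [LHS]big_mkcond /=; apply: eq_bigr => A _.
case: ifPn => [clA|nclA]; last by rewrite big1 // => q _; rewrite muln0.
under [RHS]eq_bigr => q _ do rewrite mulnbr.
rewrite -big_mkcondr /=.
rewrite [RHS](reindex_onto (fun p : V * V => ((p.1, A p.1), (p.2, A p.2)))
  (fun q => (q.1.1, q.2.1))) /=; last first.
  by move=> [[x u] [y v]] /= /and3P[_ /eqP -> /eqP ->].
by apply: eq_bigl => -[x y]; rewrite inE !eqxx !andbT.
Qed.

Lemma trace_blowup A : clique A -> trace A blowup = [set p | lt p.1 p.2].
Proof.
move=> clA; apply/setP => p; rewrite !inE /=.
case xy: (lt _ _) => //=.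
exact: (implyP (forallP (forallP clA _) _)).
Qed.

Lemma clique_exists : (0 < #|[set A | clique A]|)%N.
Proof.
apply/card_gt0P; exists 0; rewrite inE.
apply/forallP => x; apply/forallP => y; apply/implyP => _.
by rewrite /compat !ffunE addr0; exact: W_gt0.
Qed.

(** The proportionality in [sum_trace] compares [E] with the full blowup: every clique sees the
    total weight in the blowup, and only an [F]-free graph in an [F]-free [E]. *)
Lemma rho_le_weighted (R : realType) (k : nat) (F : ograph k) (r : V -> nat)
    (a : R) :
  injective r -> (forall x y, lt x y = (r x < r y)%N) -> 0 <= a ->
  (exists x y, lt x y) ->
  (forall H : {set V * V}, wf_graph lt H -> ~~ containsR F lt H ->
     (\sum_(p in H) W p.1 p.2)%:R <=
       a * (\sum_(p in [set p | lt p.1 p.2]) W p.1 p.2)%:R) ->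
  rho R F <= a.
Proof.
move=> rinj ltE a0 [x0 [y0 xy0]] HW.
have Om0 : (0 < #|Om|)%N by apply/card_gt0P; exists 0.
have K0 := clique_exists.
have eqK := sum_trace (subxx blowup).
rewrite (eq_bigr (fun=> \sum_(p in [set p | lt p.1 p.2]) W p.1 p.2)%N) in eqK; last first.
  by move=> A /trace_blowup ->.
rewrite sum_nat_cond_const in eqK.
(* Lexicographic numbering, [r] first; the order inside a fibre is immaterial because edges join
   distinct fibres. *)
pose c (p : V * Om) := (r p.1 * #|Om| + enum_rank p.2)%N.
have cinj : injective c.
  move=> [x u] [y v]; rewrite /c /= => /eqP xy.
  have := congr1 (divn^~ #|Om|) (eqP xy).
  rewrite !divnMDl // !divn_small ?addn0 ?ltn_ord // => /rinj xyE.
  by move: xy; rewrite xyE eqn_add2l => /eqP/val_inj/enum_rank_inj ->.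
have clt p q : lt p.1 q.1 -> (c p < c q)%N.
  rewrite ltE => pq; apply: leq_trans (_ : (r p.1).+1 * #|Om| <= _)%N.
    by rewrite /c mulSn addnC ltn_add2r.
  by apply: leq_trans (leq_addr _ _); rewrite leq_mul2r pq orbT.
have Wtot0 : (0 < \sum_(p in [set p | lt p.1 p.2]) W p.1 p.2)%N.
  by rewrite (bigD1 (x0, y0)) ?inE //= ltn_addr.
apply: (@rho_le_host _ _ _ _ c blowup) => //.
- by move=> x y; rewrite inE => /andP[/clt].
- rewrite lt0n; apply: contraTneq Wtot0 => B0.
  move/eqP: eqK; rewrite B0 mul0n !muln_eq0 (gtn_eqF Om0) (gtn_eqF K0) !orbF /=.
  by move=> /eqP ->.
move=> E EB FE.
have K0' : 0 < (#|[set A | clique A]| * M.+1)%:R :> R by rewrite ltr0n muln_gt0 K0.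
have eqE := sum_trace EB.
have m20 : (0 < #|Om| ^ 2)%N by rewrite expn_gt0 Om0.
move: (#|Om| ^ 2)%N m20 eqK eqE => m2 m20 eqK eqE.
rewrite -(ler_pM2r K0') -mulrA -!natrM -eqE -eqK natrM [in leRHS]natrM mulrA.
rewrite ler_pM2r ?ltr0n // natrM mulrCA natr_sum.
rewrite mulr_natl -sumr_const.
under [leRHS]eq_bigl do rewrite inE.
apply: ler_sum => A clA; apply: HW.
  apply/forallP => p; apply/implyP; rewrite inE => /(fintype.subsetP EB).
  by rewrite inE => /andP[].
apply: contra FE; apply: (containsR_map (g := fun x => (x, A x))) => [x y|x y].
  exact: (clt (x, A x) (y, A y)).
by rewrite inE.
Qed.

End Blowup.

(** * The three characterizations *)

(** At every level [l] from 1 to [d], [tau l d * 2 ^ l] equals [2 ^ (2 * d).-1], so the weight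
    [2 ^ delta] gives all levels the same total. *)
Lemma sum_level_weight (R : realType) (d : nat) (G : cgraph d) : is_cgraph G ->
  (\sum_(p in G) 2 ^ delta p.1 p.2)%:R =
  (2 ^ (2 * d).-1)%:R * \sum_(1 <= l < d.+1) ((e_level G l)%:R / (tau l d)%:R) :> R.
Proof.
move=> /forallP Gwf.
have split2 : (\sum_(p in G) 2 ^ delta p.1 p.2 =
               \sum_(i < d) e_level G i.+1 * 2 ^ i.+1)%N.
  transitivity (\sum_(p in G) \sum_(i < d) (delta p.1 p.2 == i.+1) * 2 ^ i.+1)%N.
    apply: eq_bigr => p pG; have := implyP (Gwf p) pG.
    case/lexltP=> l /at_level_delta ->; rewrite (bigD1 l) //= eqxx mul1n.
    by rewrite big1 ?addn0 // => i il; rewrite eqSS eq_sym val_eqE (negbTE il).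
  rewrite exchange_big; apply: eq_bigr => i _ /=; rewrite -big_distrl /=.
  congr (_ * _)%N; rewrite /e_level -sum1_card big_mkcond [RHS]big_mkcond /=.
  by apply: eq_bigr => p _; rewrite inE; case: (p \in G); case: (_ == _).
rewrite split2 natr_sum big_add1 big_mkord mulr_sumr; apply: eq_bigr => i _.
have -> : (2 ^ (2 * d).-1 = tau i.+1 d * 2 ^ i.+1)%N.
  by rewrite /tau -expnD; congr (_ ^ _)%N; have := ltn_ord i; lia.
have t0 : (tau i.+1 d)%:R != 0 :> R by rewrite pnatr_eq0 -lt0n expn_gt0.
move: (tau _ _) t0 => t t0; move: (2 ^ _)%N => q; rewrite !natrM.
by rewrite mulrC [t%:R * _]mulrC -mulrA [t%:R * _]mulrC divfK.
Qed.

Definition complete (d : nat) : cgraph d := [set p | lexlt p.1 p.2].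

Lemma complete_wf (d : nat) : is_cgraph (complete d).
Proof. by apply/forallP => p; rewrite inE; apply/implyP. Qed.

Lemma complete_level (R : realType) (d : nat) (l : 'I_d) :
  (e_level (complete d) l.+1)%:R / (tau l.+1 d)%:R = 1 :> R.
Proof.
rewrite -level_avg_graph ?complete_wf // /level_avg.
rewrite -[RHS](@avg_const R (cube d)) ?card_cube_gt0 //; apply: eq_avg => y.
rewrite -[RHS](@avg_const R (cube d)) ?card_cube_gt0 //; apply: eq_avg => t.
by rewrite inE /= (introT (lexltP _ _)) //; exists l; apply: at_level_splice.
Qed.

Lemma rho_le_avg_density (R : realType) (k : nat) (F : ograph k) (a : R) (d : nat) :
  (0 < d)%N -> 0 <= a ->
  (forall G : cgraph d, is_cgraph G -> a <= avg_density R G -> ccontains F G) ->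
  rho R F <= a.
Proof.
case: d => // d _ a0 HG.
have M2 n : (2 ^ n.+1).-1.+1 = (2 ^ n.+1)%N by rewrite prednK // expn_gt0.
(* The weight bound must also cover equal vertices, where [delta] takes its default value [d.+2]. *)
apply: (@rho_le_weighted (cube d.+1) (@lexlt d.+1) (fun x y => 2 ^ delta x y)%N
          (2 ^ d.+2).-1 _ _ _ _ _ _ _ (@lexrank d.+1)) => //.
- exact: lexlt_irr.
- exact: lexlt_trans.
- by move=> x y; rewrite expn_gt0.
- by move=> x y; rewrite M2 leq_exp2l // delta_le.
- exact: lexrank_inj.
- exact: lexlt_rank.
- exists [ffun=> false], [ffun=> true]; apply/lexltP; exists ord0.
  by apply/at_levelP; split; rewrite ?ffunE.
move=> H Hwf FH; rewrite sum_level_weight // sum_level_weight ?complete_wf //.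
rewrite mulrCA ler_pM2l ?ltr0n ?expn_gt0 //.
have -> : \sum_(1 <= l < d.+2) ((e_level (complete d.+1) l)%:R / (tau l d.+1)%:R)
    = d.+1%:R :> R.
  rewrite big_add1 big_mkord; under eq_bigr do rewrite complete_level.
  by rewrite sumr_const card_ord.
rewrite -ler_pdivrMr ?ltr0n // mulrC ltW // ltNge.
by apply: contra FH; exact: HG.
Qed.

Lemma avg_density_rich (R : realType) (d C : nat) (G : cgraph d) (a e : R) :
  0 <= a -> is_cgraph G -> C%:R <= d%:R * e -> a + e <= avg_density R G ->
  rich a C G.
Proof.
move=> a0 Gwf Ce; rewrite /avg_density big_add1 big_mkord => aG.
rewrite /rich -(ler_nat R); apply: le_trans Ce _.
have : d%:R * (a + e) <= \sum_(i < d) ((e_level G i.+1)%:R / (tau i.+1 d)%:R).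
  case: d G Gwf aG => [|d] G Gwf aG; first by rewrite mul0r big_ord0.
  by rewrite mulrC -ler_pdivlMr ?ltr0n // mulrC.
(* A level that is not rich contributes less than [a], and a rich one at most 1, hence at most
   [a + 1]. *)
have : \sum_(i < d) ((e_level G i.+1)%:R / (tau i.+1 d)%:R) <=
       \sum_(i < d) (a + (rich_level a G i.+1)%:R).
  apply: ler_sum => i _; case: (boolP (rich_level a G i.+1)) => [_|ni].
    by have := e_level_ratio_le1 R i Gwf; rewrite mulr1n; lra.
  rewrite addr0 ltW // ltr_pdivrMr ?ltr0n ?expn_gt0 //.
  by rewrite ltNge.
rewrite big_split /= sumr_const card_ord -[a *+ d]mulr_natl.
have -> : \sum_(i < d) (rich_level a G i.+1)%:R =
          #|[set l : 'I_d | rich_level a G l.+1]|%:R :> R.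
  rewrite -sum1_card natr_sum [RHS]big_mkcond; apply: eq_bigr => i _.
  by rewrite inE; case: (rich_level _ _ _).
by lra.
Qed.

(** A complete host contains [F], so only proper subgraphs compete in the maximum. The two extra
    vertices guarantee an edge even for [k = 0]. *)
Lemma exists_host (R : realType) (k : nat) (F : ograph k) : is_ograph F ->
  exists n (G : ograph n), [/\ is_ograph G, (0 < #|G|)%N & rhoFG R F G < 1].
Proof.
move=> Fwf; pose G : ograph k.+2 := [set p | ord_lt p.1 p.2].
have G0 : (0 < #|G|)%N by apply/card_gt0P; exists (ord0, ord_max); rewrite inE.
exists k.+2, G; split=> //.
  by apply/forallP => p; rewrite inE; apply/implyP.
apply: bigmax_lt => // G' /andP[G'G FG'].
rewrite ltr_pdivrMr ?ltr0n // mul1r ltr_nat proper_card // finset.properEneq G'G andbT.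
apply: contraNneq FG' => ->.
have kk : (k <= k.+2)%N by rewrite leqW.
apply/existsP; exists [ffun i => widen_ord kk i]; apply/andP; split; apply/forallP.
  by move=> i; apply/forallP => j; apply/implyP => ij; rewrite !ffunE.
move=> p; apply/implyP => pF; rewrite inE !ffunE.
exact: (implyP (forallP Fwf p)).
Qed.

Theorem theorem3p1 (R : realType) (k : nat) (F : ograph k) :
  is_ograph F ->
  rho R F =
    inf [set alpha : R | 0 <= alpha <= 1 /\
           exists d0 : nat, forall (d : nat) (G : cgraph d),
             (d0 <= d)%N -> is_cgraph G -> alpha <= avg_density R G ->
             ccontains F G]
  /\
  rho R F =
    inf [set alpha : R | 0 <= alpha <= 1 /\
           exists C : nat, forall (d : nat) (G : cgraph d),
             is_cgraph G -> rich alpha C G -> ccontains F G].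
Proof.
move=> Fwf; set A := (X in _ = inf X /\ _).
set B := (X in _ /\ _ = inf X).
have hostB n (G : ograph n) (g : R) : is_ograph G -> (0 < #|G|)%N ->
    rhoFG R F G < g -> g <= 1 -> B g.
  move=> Gwf G0 rg g1; split; last exact: rich_ccontains rg.
  by rewrite g1 andbT; apply: le_trans (ltW rg); apply: bigmax_ge_id.
have BA a e : B a -> 0 < e -> a + e <= 1 -> A (a + e).
  case=> /andP[a0 _] [C HC] e0 ae1; split; first by rewrite ae1 andbT; lra.
  have Ce0 : 0 <= C%:R / e by rewrite divr_ge0 ?ler0n // ltW.
  exists (Num.bound (C%:R / e)) => d G dC Gwf aG.
  apply: HC => //; apply: avg_density_rich aG => //.
  rewrite -ler_pdivrMr //; apply: le_trans (ltW (archi_boundP Ce0)) _.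
  by rewrite ler_nat.
have Alb : has_lbound A by exists 0 => x [/andP[]].
have Blb : has_lbound B by exists 0 => x [/andP[]].
(* Both sets must be nonempty for their infima to be usable. A host of ratio [r < 1] puts the
   midpoint [(r + 1) / 2] in [B] and leaves room for [BA] to reach 1. *)
have [n [G [Gwf G0 rG]]] := exists_host R Fwf.
set r := rhoFG R F G in rG.
have Bg : B ((r + 1) / 2) by apply: (hostB _ G) => //; rewrite -/r; lra.
have A1 : A 1.
  have e1 : (r + 1) / 2 + (1 - r) / 2 = 1 by lra.
  by have := BA _ ((1 - r) / 2) Bg; rewrite e1; apply; lra.
have rhoA : rho R F <= inf A.
  apply: lb_le_inf; first by exists 1.
  move=> a [/andP[a0 _] [d0 Ha]]; apply: (@rho_le_avg_density _ _ _ _ d0.+1) => //.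
  by move=> H; apply: Ha.
have AB : inf A <= inf B.
  apply: lb_le_inf; first by exists ((r + 1) / 2).
  move=> a Ba; apply/ler_addgt0Pr => e e0; have [ae|/ltW ae] := leP (a + e) 1.
    by apply: ge_inf => //; apply: BA.
  by apply: le_trans ae; apply: ge_inf.
have Brho : inf B <= rho R F.
  apply: lb_le_inf; first by exists r, n, G.
  move=> _ [m [H [Hwf H0 ->]]]; apply/ler_addgt0Pr => e e0.
  (* Beyond 1 there is no membership in [B], but the midpoint [(r + 1) / 2] found above already
     bounds [inf B]. *)
  have [he|/ltW he] := leP (rhoFG R F H + e) 1.
    by apply: ge_inf => //; apply: (hostB _ H) => //; lra.
  apply: le_trans he; apply: (@le_trans _ _ ((r + 1) / 2)); last by lra.
  exact: ge_inf.
split; apply/eqP; rewrite eq_le; apply/andP; split=> //.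
- exact: le_trans AB Brho.
- exact: le_trans rhoA AB.
Qed.
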